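(* Let $\kappa$ be an uncountable regular cardinal with $\kappa^{<\kappa}=\kappa$. (i) For every nonzero cardinal $\mu\in\kappa\cup\{\kappa,2^\kappa\}$, there exists a $\Sigma^1_1$-equivalence relation on ${}^\kappa2$ with exactly $\mu$ equivalence classes. (ii) There exists a $\Sigma^1_1$-equivalence relation on ${}^\kappa2$ with exactly $\kappa^+$ equivalence classes. (iii) If $T$ is a tree with $|T|=\kappa$, then there exists a $\Sigma^1_1$-equivalence relation on ${}^\kappa2$ with exactly $|\mathrm{Br}_\kappa(T)|+1$ equivalence classes, where $\mathrm{Br}_\kappa(T)$ is the set of all $\kappa$-branches through $T$.
   Context: ${}^\kappa2$ is the set of functions from $\kappa$ to $2$; $H(\kappa)$ is the set of all sets whose transitive closure has cardinality $<\kappa$. A first order sentence $\phi$ in the vocabulary consisting of $\in$, a unary relation symbol $S_0$ and binary relation symbols $S_1,S_2,S_3$ defines a $\Sigma^1_1$-equivalence relation $\sim_{\phi,R}$ on ${}^\kappa2$ with a parameter $R\subseteq H(\kappa)$ if the following gives an equivalence relation on ${}^\kappa 2$: for $f,g\in{}^\kappa2$, $f\sim_{\phi,R}g$ iff for some $h\in{}^\kappa2$, $\langle H(\kappa),\in,R,f,g,h\rangle\models\phi$, where $R,f,g,h$ interpret $S_0,S_1,S_2,S_3$ respectively. A $\Sigma^1_1$-equivalence relation on ${}^\kappa2$ is one of the form $\sim_{\phi,R}$ for some such $\phi$ and $R$. A $\kappa$-branch through a tree is a linearly ordered, downward closed subset of order type $\kappa$. *)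

(* Defs.v *)
From HB Require Import structures.
From Stdlib Require Import Relation_Operators.
From mathcomp Require Import all_boot.
From mathcomp Require Import boolp classical_sets functions cardinality wochoice.

Set Implicit Arguments.
Unset Strict Implicit.
Unset Printing Implicit Defensive.

Local Open Scope classical_set_scope.
Local Open Scope card_scope.

(* The universe of sets: well-founded trees (Aczel's construction) up to
   bisimilarity.  The quotient makes Leibniz equality extensional. *)

Inductive aczel : Type := Sup (A : Type) (F : A -> aczel).

Fixpoint bisim (x y : aczel) {struct x} : Prop :=
  match x, y with
  | Sup A F, Sup B G =>
      (forall a, exists b, bisim (F a) (G b)) /\
      (forall b, exists a, bisim (F a) (G b))
  end.

Definition zset : Type := {C : aczel -> Prop | exists x, C = bisim x}.

HB.instance Definition _ := gen_eqMixin zset.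
HB.instance Definition _ := gen_choiceMixin zset.

Definition cls (x : aczel) : zset := exist _ (bisim x) (ex_intro _ x erefl).

Definition elts (X : zset) : set zset :=
  [set Y | exists (A : Type) (F : A -> aczel) (a : A),
             X = cls (Sup F) /\ Y = cls (F a)].

Notation "Y ∈ X" := (elts X Y) (at level 70).

Definition zempty : zset := cls (Sup (fun e : Empty_set => match e with end)).
Definition zone : zset :=
  cls (Sup (fun _ : unit => Sup (fun e : Empty_set => match e with end))).

Definition strict_well_order (T : Type) (A : set T) (lt : T -> T -> Prop) :=
  [/\ forall x y z, A x -> A y -> A z -> lt x y -> lt y z -> lt x z,
      forall x y, A x -> A y -> [\/ lt x y, x = y | lt y x]
    & forall B, B `<=` A -> B !=set0 ->
        exists2 m, B m & forall x, B x -> ~ lt x m].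

Definition is_ordinal (a : zset) :=
  (forall b, b ∈ a -> elts b `<=` elts a) /\
  strict_well_order (elts a) (fun x y => x ∈ y).

Definition is_cardinal (k : zset) :=
  is_ordinal k /\ forall a, a ∈ k -> elts a #!= elts k.

Definition card_lt T U (A : set T) (B : set U) := A #<= B /\ ~ (B #<= A).

Definition uncountable (k : zset) := ~ countable (elts k).

(* cf(k) = k: no map from an ordinal below k is cofinal in k. *)
Definition regular (k : zset) :=
  forall a, a ∈ k -> forall f : elts a -> elts k,
    exists2 b, b ∈ k & forall x, val (f x) ∈ b.

(* The disjoint union of the function sets ^α k for α < k has size k. *)
Definition weak_power_eq (k : zset) :=
  [set: {a : elts k & elts (val a) -> elts k}] #= elts k.

Definition is_card_of T (A : set T) (m : zset) := is_cardinal m /\ A #= elts m.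

(* The choice in the next two definitions is from a nonempty set, see
   two_powerP and succ_cardP; the values are unique. *)
Definition two_power (k : zset) : zset :=
  xget zempty [set m | is_card_of [set: elts k -> bool] m].

Definition is_succ_card (k l : zset) :=
  [/\ is_cardinal l, k ∈ l
    & forall m, is_cardinal m -> k ∈ m -> m = l \/ l ∈ m].

Definition succ_card (k : zset) : zset := xget zempty [set l | is_succ_card k l].

Definition trans_closure (x : zset) : set zset :=
  [set y | clos_trans zset (fun u v => u ∈ v) y x].

Definition H (k : zset) : set zset :=
  [set x | card_lt (trans_closure x) (elts k)].

Inductive formula : Type :=
| FEq of nat & nat
| FMem of nat & nat
| FS0 of nat
| FS1 of nat & nat
| FS2 of nat & nat
| FS3 of nat & nat
| FNot of formula
| FAnd of formula & formula
| FEx of nat & formula.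

Fixpoint free_vars (p : formula) : seq nat :=
  match p with
  | FEq i j | FMem i j | FS1 i j | FS2 i j | FS3 i j => [:: i; j]
  | FS0 i => [:: i]
  | FNot q => free_vars q
  | FAnd q r => free_vars q ++ free_vars r
  | FEx i q => [seq j <- free_vars q | j != i]
  end.

Definition sentence (p : formula) := free_vars p = [::].

Record structure := Structure {
  dom : Type;
  int_mem : dom -> dom -> Prop;
  int_S0 : dom -> Prop;
  int_S1 : dom -> dom -> Prop;
  int_S2 : dom -> dom -> Prop;
  int_S3 : dom -> dom -> Prop }.

Definition update D (v : nat -> D) (i : nat) (d : D) : nat -> D :=
  fun j => if j == i then d else v j.

Fixpoint holds (M : structure) (v : nat -> dom M) (p : formula) : Prop :=
  match p with
  | FEq i j => v i = v j
  | FMem i j => int_mem (v i) (v j)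
  | FS0 i => int_S0 (v i)
  | FS1 i j => int_S1 (v i) (v j)
  | FS2 i j => int_S2 (v i) (v j)
  | FS3 i j => int_S3 (v i) (v j)
  | FNot q => ~ holds v q
  | FAnd q r => holds v q /\ holds v r
  | FEx i q => exists d, holds (update v i d) q
  end.

Definition models (M : structure) (p : formula) :=
  forall v : nat -> dom M, holds v p.

(* ^k 2; the values false and true are the ordinals 0 and 1. *)
Definition cantor_space (k : zset) : Type := elts k -> bool.

(* f as a set of pairs (α, f α), that is, as a binary relation on H(k) *)
Definition graph (k : zset) (f : cantor_space k) (x y : H k) : Prop :=
  exists a : elts k, val x = val a /\ val y = if f a then zone else zempty.

Definition Hstructure (k : zset) (R : set (H k)) (f g h : cantor_space k) :=
  @Structure (H k) (fun x y => val x ∈ val y) R (graph f) (graph g) (graph h).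

Definition sim (k : zset) (p : formula) (R : set (H k))
    (f g : cantor_space k) : Prop :=
  exists h : cantor_space k, models (Hstructure R f g h) p.

Definition Sigma11_equivalence (k : zset)
    (E : cantor_space k -> cantor_space k -> Prop) : Prop :=
  exists (p : formula) (R : set (H k)),
    [/\ sentence p, RelationClasses.Equivalence (sim p R) & E = sim p R].

Definition classes (X : Type) (E : X -> X -> Prop) : set (set X) :=
  [set C | exists x, C = [set y | E x y]].

Definition is_tree (T : Type) (lt : T -> T -> Prop) :=
  [/\ forall x, ~ lt x x, forall x y z, lt x y -> lt y z -> lt x z
    & forall t, strict_well_order [set s | lt s t] lt].

Definition is_branch (k : zset) (T : Type) (lt : T -> T -> Prop) (B : set T) :=
  [/\ forall x y, B x -> B y -> [\/ lt x y, x = y | lt y x],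
      forall x y, B y -> lt x y -> B x
    & exists h : elts k -> B, bijective h /\
        forall a b, val a ∈ val b <-> lt (val (h a)) (val (h b))].

Definition branches (k : zset) (T : Type) (lt : T -> T -> Prop) : set (set T) :=
  [set B | is_branch k lt B].

Lemma bisim_refl x : bisim x x.
Proof. by elim: x => A F IH /=; split=> a; exists a. Qed.

Lemma bisim_sym x y : bisim x y -> bisim y x.
Proof.
elim: x y => A F IH [B G] /= [h1 h2]; split.
  by move=> b; have [a ab] := h2 b; exists a; apply: IH.
by move=> a; have [b ab] := h1 a; exists b; apply: IH.
Qed.

Lemma bisim_trans x y z : bisim x y -> bisim y z -> bisim x z.
Proof.
elim: x y z => A F IH [B G] [C K] /= [h1 h2] [h3 h4]; split.
  move=> a; have [b ab] := h1 a; have [c bc] := h3 b.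
  by exists c; apply: IH ab bc.
move=> c; have [b bc] := h4 c; have [a ab] := h2 b.
by exists a; apply: IH ab bc.
Qed.

Lemma cls_bisim x y : cls x = cls y -> bisim x y.
Proof. by case=> ->; apply: bisim_refl. Qed.

Lemma bisim_cls x y : bisim x y -> cls x = cls y.
Proof.
move=> xy; apply: eq_exist; apply/funext => z; apply/propext; split.
  by apply: bisim_trans; apply: bisim_sym.
exact: bisim_trans.
Qed.

Lemma cls_surj (X : zset) : exists x, X = cls x.
Proof. by case: X => C [x eC]; exists x; apply: eq_exist. Qed.

Lemma elts_cls (A : Type) (F : A -> aczel) Y :
  Y ∈ cls (Sup F) <-> exists a, Y = cls (F a).
Proof.
split=> [[B [G [b [/cls_bisim[_ h] ->]]]]|[a ->]]; last by exists A, F, a.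
by have [a ab] := h b; exists a; apply/esym/bisim_cls.
Qed.

Lemma elts_inj : injective elts.
Proof.
move=> X Y; have [[A F] ->] := cls_surj X; have [[B G] ->] := cls_surj Y => e.
apply: bisim_cls; split=> [a|b].
  have : cls (F a) ∈ cls (Sup F) by apply/elts_cls; exists a.
  by rewrite e => /elts_cls[b /cls_bisim ab]; exists b.
have : cls (G b) ∈ cls (Sup G) by apply/elts_cls; exists b.
by rewrite -e => /elts_cls[a /cls_bisim/bisim_sym ab]; exists a.
Qed.

Lemma mem_wf : well_founded (fun x y => x ∈ y).
Proof.
move=> X; have [x ->] := cls_surj X; elim: x => A F IH.
by constructor=> Y /elts_cls[a ->].
Qed.

Lemma mem_min (P : set zset) : P !=set0 ->
  exists2 m, P m & forall x, P x -> ~ x ∈ m.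
Proof.
case=> x; elim: (mem_wf x) => {}x _ IH Px.
have [[y [yx Py]]|no] := pselect (exists y, y ∈ x /\ P y); first exact: IH yx Py.
by exists x => // y Py yx; apply: no; exists y.
Qed.

Lemma mem_irr x : ~ x ∈ x.
Proof.
have [|m -> h] := @mem_min [set x]; first by exists x.
exact: h.
Qed.

(* Replacement for families indexed by a type small enough to index Sup *)
Lemma zset_of (A : Type) (F : A -> zset) : {X | elts X = range F}.
Proof.
pose G a := sval (cid (cls_surj (F a))).
have GE a : F a = cls (G a) by rewrite /G; case: cid.
exists (cls (Sup G)); apply/seteqP; split=> [Y /elts_cls[a ->]|_ [a _ <-]].
  by exists a.
by apply/elts_cls; exists a.
Qed.

Lemma elts_small (X : zset) :
  exists (A : Type) (F : A -> zset), injective F /\ elts X = range F.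
Proof.
have [[B G] ->] := cls_surj X.
pose pick Y (h : exists b, Y = cls (G b)) : B := sval (cid h).
have pickE Y h : cls (G (@pick Y h)) = Y by rewrite /pick; case: cid.
pose q b := pick (cls (G b)) (ex_intro _ b erefl).
have qE b c : cls (G b) = cls (G c) -> q b = q c.
  rewrite /q; move: (ex_intro _ b _) (ex_intro _ c _) => h1 h2 e.
  by case: _ / e h2 => h2; congr pick; apply: Prop_irrelevance.
exists {b | q b = b}, (fun b => cls (G (sval b))); split.
  move=> [b qb] [c qc] /= e; apply: eq_exist.
  by rewrite -qb -qc; apply: qE.
apply/seteqP; split=> [Y /elts_cls[b ->]|_ [[b qb] _ <-]]; last first.
  by apply/elts_cls; exists b.
have qq : q (q b) = q b by apply: qE; rewrite pickE.
by exists (exist (fun b => q b = b) (q b) qq) => //=; rewrite pickE.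
Qed.

Lemma zset_sep (X : zset) (P : set zset) : {Y | elts Y = elts X `&` P}.
Proof.
apply/cid; have [A [F [_ XE]]] := elts_small X.
have [Y YE] := zset_of (fun a : {a | P (F a)} => F (sval a)).
exists Y; rewrite YE XE; apply/seteqP; split=> [_ [[a Pa] _ <-]|_ [[a _ <-] Pa]].
  by split=> //; exists a.
by exists (exist (fun a => P (F a)) a Pa).
Qed.

Lemma ordinal_mem a b : is_ordinal a -> b ∈ a -> is_ordinal b.
Proof.
move=> [tr [t tot mn]] ba; split=> [c cb d dc|].
  have ca := tr _ ba _ cb; have da := tr _ ca _ dc.
  exact: t dc cb.
split=> [x y z xb yb zb|x y xb yb|B Bb]; last first.
- by apply: mn; apply: subset_trans Bb (tr _ ba).
- by apply: tot; apply: (tr _ ba).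
- by apply: t; apply: (tr _ ba).
Qed.

Lemma ordinal_sub a b : (forall c, c ∈ a -> elts c `<=` elts a) ->
  is_ordinal b -> elts a `<=` elts b -> a <> b -> a ∈ b.
Proof.
move=> tra [trb [t tot _]] ab neq.
have [|m [mb ma] mmin] := @mem_min (elts b `\` elts a).
  by apply/set0P/eqP ; rewrite setD_eq0 => ba; apply: neq; apply/elts_inj/seteqP.
suff -> : a = m by [].
apply/elts_inj/seteqP; split=> x.
  move=> xa; have [//|e|mx] := tot x m (ab _ xa) mb.
    by rewrite e in xa.
  by case: ma; apply: tra mx.
move=> xm; have xb := trb _ mb _ xm.
by apply: contrapT => xa; apply: (mmin x).
Qed.

Lemma ordinal_trichotomy a b : is_ordinal a -> is_ordinal b ->
  [\/ a ∈ b, a = b | b ∈ a].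
Proof.
move=> oa ob; have [g gE] := zset_sep a (elts b).
have trg c : c ∈ g -> elts c `<=` elts g.
  rewrite gE => -[ca cb] d dc; split; first by case: oa => tr _; apply: tr dc.
  by case: ob => tr _; apply: tr dc.
have [ga|ga] := pselect (g = a); last have [gb|gb] := pselect (g = b).
- have [e|ne] := pselect (a = b); first by constructor 2.
  constructor 1; apply: ordinal_sub => //; first by case: oa.
  by rewrite -ga gE => x [].
- constructor 3; apply: ordinal_sub => //; first by case: ob.
    by rewrite -gb gE => x [].
  by rewrite -gb.
- case: (@mem_irr g); rewrite gE; split.
    by apply: ordinal_sub => //; rewrite gE => x [].
  by apply: ordinal_sub => //; rewrite gE => x [].
Qed.

Lemma ordinal_of_type (A : Type) : exists2 a, is_ordinal a & [set: A] #= elts a.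
Proof.
have [R Rwo] := well_ordering_principle {classic A}.
have Rmin (P : set A) : P !=set0 ->
    exists2 m, P m & forall x, P x -> R m x.
  move=> [x Px]; have [|m [[mP mmin] _]] := Rwo (fun y => y \in P).
    by exists x; apply: mem_set.
  by exists m => [|y Py]; [apply: set_mem|apply: mmin; apply: mem_set].
have Rch : wo_chain R predT by move=> P _; apply: Rwo.
have Rtot x y : R x y || R y x by apply: (wo_chainW Rch).
have Rxx x : R x x by rewrite -[R x x]orbb.
have Ranti x y : R x y -> R y x -> x = y.
  by move=> xy yx; apply: (wo_chain_antisymmetric Rch) => //; apply/andP.
pose r (x y : A) : Prop := R x y /\ x <> y.
have rwf : well_founded r.
  move=> x; apply: contrapT => nx.
  have [|m nm mmin] := Rmin [set y | ~ Acc r y]; first by exists x.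
  apply: nm; constructor=> y [ym ne]; apply: contrapT => ny.
  by apply: ne; apply: Ranti => //; apply: mmin.
have rtot x y : [\/ r x y, x = y | r y x].
  have [->|ne] := pselect (x = y); first by constructor 2.
  have /orP[xy|yx] := Rtot x y; first by constructor 1.
  by constructor 3; split=> // e; apply: ne.
have rtr x y z : r x y -> r y z -> r x z.
  move=> xy yz; have [//|e|zx] := rtot x z.
    case: xy => xy ne; case: yz => yz _; case: ne; rewrite e in xy *.
    exact: Ranti.
  have [|m mP mmin] := Rmin [set x; y; z]; first by exists x; left; left.
  case: mP => [[]|] /= em; subst m.
  + by case: zx => zx; case; apply: Ranti => //; apply: mmin; right.
  + by case: xy => xy; case; apply: Ranti => //; apply: mmin; left; left.
  + by case: yz => yz; case; apply: Ranti => //; apply: mmin; left; right.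
pose step x (f : forall y, r y x -> zset) : zset :=
  sval (zset_of (fun y : {y | r y x} => f (sval y) (proj2_sig y))).
pose rk := Fix rwf (fun=> zset) step.
have rkE x : elts (rk x) = [set rk y | y in [set y | r y x]].
  rewrite /rk Fix_eq; last first.
    move=> y f g fg; congr step.
    by apply/functional_extensionality_dep => z; apply/funext.
  rewrite /step; case: zset_of => Y /= ->.
  apply/seteqP; split=> [_ [[y yx] _ <-]|_ [y yx <-]]; first by exists y.
  by exists (exist (fun y => r y x) y yx).
have rk_mono x y : r x y -> rk x ∈ rk y by move=> xy; rewrite rkE; exists x.
have rk_inj : injective rk.
  move=> x y e; have [/rk_mono|//|/rk_mono] := rtot x y; rewrite e;
    by move/mem_irr.
have rk_mem x y : rk x ∈ rk y -> r x y.
  by rewrite rkE => -[z zy /rk_inj <-].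
have [a aE] := zset_of rk; exists a; last first.
  by rewrite aE card_eq_sym; apply: inj_card_eq => x y _ _; apply: rk_inj.
split=> [b|].
  rewrite aE => -[x _ <-] c; rewrite rkE => -[y _ <-]; by exists y.
rewrite aE; split.
- move=> _ _ _ [x _ <-] [y _ <-] [z _ <-] /rk_mem xy /rk_mem yz.
  by apply: rk_mono; apply: rtr yz.
- move=> _ _ [x _ <-] [y _ <-].
  have [xy|->|yx] := rtot x y; first by constructor 1; apply: rk_mono.
    by constructor 2.
  by constructor 3; apply: rk_mono.
- by move=> B _; apply: mem_min.
Qed.

Lemma card_exists (T A : Type) (f : T -> A) : injective f ->
  exists m, is_card_of [set: T] m.
Proof.
move=> f_inj; have [a0 oa0 ea0] := ordinal_of_type {b | exists t, f t = b}.
have Ta0 : [set: T] #= elts a0.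
  apply: card_eq_trans ea0.
  pose g t : {b | exists t, f t = b} := exist _ (f t) (ex_intro _ t erefl).
  have gE : range g = [set: {b | exists t, f t = b}].
    apply/seteqP; split=> // -[b hb] _; have [t tb] := hb.
    by exists t => //; apply: eq_exist.
  by rewrite -gE card_eq_sym; apply: inj_card_eq => x y _ _ [/f_inj].
have [|m [om Tm] mmin] := @mem_min [set a | is_ordinal a /\ [set: T] #= elts a].
  by exists a0.
exists m; split=> //; split=> // b bm; apply/negP => bE.
apply: (mmin b) => //; split; first exact: ordinal_mem bm.
by apply: card_eq_trans Tm _; rewrite card_eq_sym.
Qed.

Lemma card_of_uniq T (A : set T) m n :
  is_card_of A m -> is_card_of A n -> m = n.
Proof.
move=> [[om cm] Am] [[on cn] An].
have mn : elts m #= elts n by apply: card_eq_trans An; rewrite card_eq_sym.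
have [/cn|//|/cm] := ordinal_trichotomy om on; first by rewrite mn.
by rewrite card_eq_sym mn.
Qed.

Lemma two_powerP k : is_card_of [set: elts k -> bool] (two_power k).
Proof.
apply: xgetPex; have [A [F [_ kE]]] := elts_small k.
have Fk a : F a \in elts k by rewrite kE; apply: mem_set; exists a.
apply: (@card_exists _ (A -> bool) (fun g a => g (exist _ (F a) (Fk a)))).
move=> g h e; apply/funext => -[x xk].
have [a _ ax] : range F x by rewrite -kE; apply: set_mem.
have -> : exist _ x xk = exist _ (F a) (Fk a) :> elts k by apply: eq_exist.
exact: (congr1 (fun g => g a) e).
Qed.

Lemma mem_two_power k : is_cardinal k -> k ∈ two_power k.
Proof.
move=> [ok ck]; have [[op cp] pE] := two_powerP k.
have nle : ~ (elts (two_power k) #<= elts k).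
  rewrite -(card_le_eql pE) => /card_leP[f].
  pose g (x : elts k) :=
    `[< exists2 u : elts k -> bool, f (to_setT u) = x & ~~ u x >].
  have [gx|gx] := boolP (g (f (to_setT g))).
    have /asboolP[u fu] := gx.
    suff -> : u = g by rewrite gx.
    by have /(congr1 val) := injT fu.
  by move: (gx) => /asboolP; apply; exists g.
have [//|e|pk] := ordinal_trichotomy ok op.
  by case: nle; rewrite -e card_lexx.
by case: nle; apply: subset_card_le; case: ok => tr _; apply: tr.
Qed.

Lemma succ_cardP k : is_cardinal k -> is_succ_card k (succ_card k).
Proof.
move=> ck; apply: xgetPex.
have [|l [cl kl] lmin] := @mem_min [set m | is_cardinal m /\ k ∈ m].
  exists (two_power k); split; last exact: mem_two_power.
  by case: (two_powerP k).
exists l; split=> // m cm km.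
case: (cl) (cm) => ol _ [om _].
have [||] := ordinal_trichotomy om ol; [|by left|by right].
by move=> ml; case: (lmin m).
Qed.

(* Main.v *)
From Stdlib Require Import Relation_Operators Inverse_Image.
Require Import Defs.
From mathcomp Require Import all_boot.
From mathcomp Require Import boolp classical_sets functions cardinality.

Set Implicit Arguments.
Unset Strict Implicit.
Unset Printing Implicit Defensive.

Local Open Scope classical_set_scope.
Local Open Scope card_scope.

(** Each equivalence relation has the form F f = F g for a map F defined on
    the whole of ^k 2.  Its classes are then the fibres of F, so they are
    counted by the range of F ([sigma11_of_invariant]), and the work lies in
    choosing F so that F f = F g is expressible by a sentence over H(k).  The
    parameter R holds the triples (a, b, c) of a ternary relation on k, coded
    by Kuratowski pairs; those are elements of H(k) because a union of two
    sets of size less than k has size less than k ([card_lt_setU]).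

    For 2^k classes, F is the identity.  For a nonzero ordinal m contained in
    k, and in particular for a cardinal m <= k, F f is the least a with f a = 1
    if there is one and it lies in m, and 0 otherwise ([sigma11_ordinal]).

    For a tree T of size k, identify T with k and let R code the order of T.  A
    function f codes a set of nodes B, and F f is B if B is a k-branch and a
    junk value otherwise.  Being a k-branch is first order ([decoded_branch],
    [branch_decoded]): B is linearly ordered and downward closed, it is
    unbounded in k, and the predecessors of each of its nodes are bounded in
    k.  By regularity, the last two clauses say that B has size k and its
    proper initial segments have size less than k, that is, that its order
    type is k.

    For k^+ classes, let R code an injection from k x k to k, so that f codes a
    binary relation on k.  If that relation is transitive and well-founded, its
    Mostowski collapse has as its image a nonzero ordinal, and F f is that
    ordinal; otherwise F f = 0.  Every nonzero ordinal below k^+ arises, from a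
    surjection of k onto it ([range_height]).  Well-foundedness is first order
    over H(k), since k is regular and uncountable: a descending sequence is a
    bounded subset of k, hence an element of H(k) ([has_minima_wf]).  Two
    well-founded relations have the same image under the collapse exactly when
    some bisimulation between them is total on both sides, and the existential
    quantifier over h provides the bisimulation ([height_eq]). *)

(** * Cardinality and replacement *)

Lemma card_le_map T U (A : set T) (B : set U) (f : T -> U) :
  (forall x, A x -> B (f x)) ->
  (forall x y, A x -> A y -> f x = f y -> x = y) -> A #<= B.
Proof.
move=> fAB f_inj; have <- : (f @` A #<= B) = (A #<= B).
  apply: card_le_eql; apply: inj_card_eq => x y /set_mem Ax /set_mem Ay.
  exact: f_inj.
by apply: subset_card_le => _ [x Ax <-]; apply: fAB.
Qed.

Lemma card_le_type T U (A : set T) (B : set U) (f : A -> B) :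
  injective f -> A #<= B.
Proof.
move=> f_inj; rewrite -(card_le_eql (card_setT A)).
apply: (@card_le_map _ _ _ _ (val \o f)) => [x _|x y _ _ /val_inj/f_inj //].
exact: set_valP.
Qed.

Lemma card_le_elim T U (A : set T) (B : set U) :
  A #<= B -> exists f : A -> B, injective f.
Proof. by move=> /card_leP[f]; exists f; apply: injT. Qed.

Lemma card_ltW T U (A : set T) (B : set U) : card_lt A B -> A #<= B.
Proof. by case. Qed.

Lemma card_le_lt_trans T U V (A : set T) (B : set U) (C : set V) :
  A #<= B -> card_lt B C -> card_lt A C.
Proof.
move=> AB [BC CB]; split; first exact: card_le_trans BC.
by move=> CA; apply: CB; apply: card_le_trans AB.
Qed.

(** [c] makes [U] no larger than the set [X], so the Replacement axiom applies
    to families indexed by [U], in whatever universe [U] lives. *)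
Lemma zset_image (X : zset) (U : Type) (c : U -> zset) (G : U -> zset) :
  injective c -> (forall u, c u ∈ X) -> {Y | elts Y = range G}.
Proof.
move=> c_inj cX; apply/cid; have [A [F [F_inj XE]]] := elts_small X.
pose pre (a : {a | exists u, F a = c u}) : U := sval (cid (proj2_sig a)).
have preE a : F (sval a) = c (pre a) by rewrite /pre; case: cid.
have [Y YE] := zset_of (fun a => G (pre a)).
exists Y; rewrite YE; apply/seteqP; split=> [_ [a _ <-]|_ [u _ <-]].
  by exists (pre a).
have : range F (c u) by rewrite -XE; apply: cX.
move=> [a _ au]; exists (exist _ a (ex_intro _ u au)) => //.
by congr G; apply: c_inj; rewrite -preE.
Qed.

Lemma zset_of_card_le (X : zset) (S : set zset) :
  S #<= elts X -> exists Y, elts Y = S.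
Proof.
move=> /card_le_elim[f f_inj].
have [Y YE] := @zset_image X S (val \o f) val (inj_comp val_inj f_inj)
  (fun u => set_valP (f u)).
exists Y; rewrite YE; apply/seteqP; split=> [_ [u _ <-]|x Sx].
  exact: set_valP.
by exists (SigSub (mem_set Sx)).
Qed.

Lemma zset_setU (x y : zset) : {z | elts z = elts x `|` elts y}.
Proof.
apply/cid; have [A [F [_ ->]]] := elts_small x.
have [B [G [_ ->]]] := elts_small y.
have [z zE] := zset_of (fun i => match i with inl a => F a | inr b => G b end).
exists z; rewrite zE; apply/seteqP; split=> [_ [[a|b] _ <-]|_ [] [a _ <-]].
- by left; exists a.
- by right; exists b.
- by exists (inl a).
- by exists (inr a).
Qed.

Lemma card_of_card_le (X : zset) T (A : set T) :
  A #<= elts X -> exists m, is_card_of A m.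
Proof.
move=> /card_le_elim[f f_inj]; have [I [F [F_inj XE]]] := elts_small X.
(* J is a copy of A in the universe that can index the elements of a set. *)
pose J := {i | exists u : A, F i = val (f u)}.
have /choice[i iE] (u : A) : exists i, F i = val (f u).
  have : range F (val (f u)) by rewrite -XE; apply: set_valP.
  by case=> i _; exists i.
pose j u : J := exist _ (i u) (ex_intro _ u (iE u)).
have j_inj : injective j.
  by move=> u v /(congr1 sval) /= uv; apply/f_inj/val_inj; rewrite -!iE uv.
have JA : range j = [set: J].
  apply/seteqP; split=> // -[i0 iu] _; have [u i0u] := iu; exists u => //.
  by apply: eq_exist; apply: F_inj; rewrite iE.
have [m [cm Jm]] := @card_exists J J id (@inj_id J).
exists m; split=> //; apply: card_eq_trans Jm.
rewrite -(card_eql (card_setT A)) card_eq_sym -JA.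
by apply: inj_card_eq => u v _ _ /j_inj.
Qed.

(** * Mostowski collapse *)

Definition collapses U (r : U -> U -> Prop) (rk : U -> zset) :=
  forall x, elts (rk x) = rk @` [set y | r y x].

Definition transitive_rel U (r : U -> U -> Prop) :=
  forall x y z, r x y -> r y z -> r x z.

Lemma collapse_exists (X : zset) (U : Type) (c : U -> zset)
    (r : U -> U -> Prop) :
  injective c -> (forall u, c u ∈ X) -> well_founded r ->
  exists rk, collapses r rk.
Proof.
move=> c_inj cX rwf.
have c'_inj x : injective (fun y : {y | r y x} => c (sval y)).
  by move=> [y yx] [z zx] /c_inj /= yz; apply: eq_exist.
pose step x (f : forall y, r y x -> zset) : zset :=
  sval (zset_image (fun y : {y | r y x} => f (sval y) (proj2_sig y))
    (@c'_inj x) (fun y => cX (sval y))).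
exists (Fix rwf (fun=> zset) step) => x; rewrite Fix_eq; last first.
  move=> y f g fg; congr step.
  by apply/functional_extensionality_dep => z; apply/funext.
rewrite {1}/step; case: zset_image => Y /= ->.
apply/seteqP; split=> [_ [[y yx] _ <-]|_ [y yx <-]]; first by exists y.
by exists (exist (fun y => r y x) y yx).
Qed.

(** Extensionality identifies the collapses of bisimilar points, so equality of
    collapses has an existential witness: a relation between the domains. *)
Definition bisimulation U V (r : U -> U -> Prop) (s : V -> V -> Prop)
    (h : U -> V -> Prop) :=
  forall x y, h x y ->
    (forall x', r x' x -> exists y', s y' y /\ h x' y') /\
    (forall y', s y' y -> exists x', r x' x /\ h x' y').

Lemma bisimulation_collapse U V (r : U -> U -> Prop) (s : V -> V -> Prop)
    (h : U -> V -> Prop) rk rk' :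
  well_founded r -> collapses r rk -> collapses s rk' -> bisimulation r s h ->
  forall x y, h x y -> rk x = rk' y.
Proof.
move=> rwf rkE rk'E hb x; elim: (rwf x) => {}x _ IH y xy.
have [h1 h2] := hb _ _ xy; apply: elts_inj; rewrite rkE rk'E.
apply/seteqP; split=> _ [z /= zr <-].
  by have [y' [sy' zy']] := h1 _ zr; exists y' => //; rewrite (IH _ zr _ zy').
by have [x' [rx' x'z]] := h2 _ zr; exists x' => //; apply: IH.
Qed.

Lemma ordinal_trans_of_ordinals a :
  (forall b, b ∈ a -> elts b `<=` elts a) ->
  (forall b, b ∈ a -> is_ordinal b) ->
  is_ordinal a.
Proof.
move=> tra oa; split=> //; split=> [x y z xa ya za xy yz|x y xa ya|B _].
- by have [trz _] := oa _ za; apply: trz xy.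
- by apply: ordinal_trichotomy; apply: oa.
- exact: mem_min.
Qed.

Lemma collapse_ordinal U (r : U -> U -> Prop) rk a :
  well_founded r -> transitive_rel r -> collapses r rk -> elts a = range rk ->
  is_ordinal a.
Proof.
move=> rwf rtr rkE aE.
have tr x b : b ∈ rk x -> elts b `<=` elts (rk x).
  rewrite rkE => -[y yx <-]; rewrite rkE => _ [z zy <-].
  by rewrite /=; exists z => //; apply: rtr yx.
apply: ordinal_trans_of_ordinals => b; rewrite aE => -[x _ <-].
  by rewrite rkE => _ [y _ <-]; exists y.
elim: (rwf x) => {}x _ IH; apply: ordinal_trans_of_ordinals; first exact: tr.
by move=> c; rewrite rkE => -[y yx <-]; apply: IH.
Qed.

(** * Sets of size less than an uncountable regular cardinal *)

Lemma elts_zempty : elts zempty = set0.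
Proof. by apply/seteqP; split=> // x /elts_cls[[]]. Qed.

Lemma ordinal_trans a b c : is_ordinal a -> b ∈ a -> c ∈ b -> c ∈ a.
Proof. by move=> [tr _] ba; apply: tr. Qed.

Lemma zempty_mem a : is_ordinal a -> a <> zempty -> zempty ∈ a.
Proof.
move=> oa a0; have [|b ba bmin] := @mem_min (elts a).
  apply: contrapT => a_empty; apply: a0; apply: elts_inj.
  apply/seteqP; split=> x; first by move=> xa; case: a_empty; exists x.
  by move=> /elts_cls[[]].
suff <- : b = zempty by [].
apply: elts_inj; apply/seteqP; split=> x; last by move=> /elts_cls[[]].
by move=> xb; case: (bmin x) => //; apply: ordinal_trans xb.
Qed.

Lemma card_lt_mem k a : is_cardinal k -> a ∈ k -> card_lt (elts a) (elts k).
Proof.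
move=> [ok ck] ak; have ak' : elts a #<= elts k.
  by apply: subset_card_le => x; apply: ordinal_trans.
by split=> // ka; have := ck _ ak; rewrite card_eq_le ak' ka.
Qed.

Lemma card_lt_ordinal k T (A : set T) : is_cardinal k ->
  card_lt A (elts k) -> exists2 a, a ∈ k & A #= elts a.
Proof.
move=> ck [Ak kA]; have [m [[om cm] Am]] := card_of_card_le Ak.
exists m => //.
have ok : is_ordinal k by case: ck.
have nkm : ~ (elts k #<= elts m) by rewrite -(card_le_eqr Am).
have [//|mk|km] := ordinal_trichotomy om ok; case: nkm.
  by rewrite mk card_lexx.
by apply: subset_card_le => x; apply: ordinal_trans.
Qed.

Lemma countable_card_lt k T (A : set T) : uncountable k ->
  countable A -> card_lt A (elts k).
Proof.
move=> kunc Ac; split; last by move=> kA; apply: kunc; apply: sub_countable Ac.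
apply: card_le_trans Ac _; apply/infiniteP => kfin.
by apply: kunc; apply: finite_set_countable.
Qed.

Section RegularCardinal.
Variable k : zset.
Hypotheses (k_card : is_cardinal k) (k_unc : uncountable k)
  (k_reg : regular k).

Let ok : is_ordinal k. Proof. by case: k_card. Qed.

Lemma k_inhabited : inhabited (elts k).
Proof.
have [a ak] : exists a, a ∈ k.
  exists zempty; apply: zempty_mem => // k0; apply: k_unc; rewrite k0.
  by rewrite elts_zempty; apply: countable0.
by exists; apply: (SigSub (mem_set ak)).
Qed.

Lemma bounded_of_card_lt (S : set zset) :
  S `<=` elts k -> card_lt S (elts k) -> exists2 b, b ∈ k & S `<=` elts b.
Proof.
move=> Sk /(card_lt_ordinal k_card)[a ak]; rewrite card_eq_sym.
move=> /card_bijP[f [g fK gK]].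
have fk x : val (f x) \in elts k by apply/mem_set/Sk/set_valP.
have [b bk fb] := k_reg ak (fun x => SigSub (fk x)).
exists b => // x Sx.
by have := fb (g (SigSub (mem_set Sx))); rewrite /= gK.
Qed.

Lemma mem_max a b : a ∈ k -> b ∈ k ->
  exists2 c, c ∈ k & elts a `<=` elts c /\ elts b `<=` elts c.
Proof.
move=> ak bk; have oa := ordinal_mem ok ak; have ob := ordinal_mem ok bk.
have [ab|->|ba] := ordinal_trichotomy oa ob.
- by exists b => //; split=> // x xa; apply: ordinal_trans xa.
- by exists b => //; split.
- by exists a => //; split=> // x xb; apply: ordinal_trans xb.
Qed.

(** Otherwise [k] would inject into [A `|` B], hence split into two subsets of
    size less than [k]; both are bounded, and so would be [k]. *)
Lemma card_lt_setU (A B : set zset) :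
  card_lt A (elts k) -> card_lt B (elts k) -> card_lt (A `|` B) (elts k).
Proof.
have half (C : set zset) (f : elts k -> zset) :
    injective f -> card_lt C (elts k) ->
    exists2 b, b ∈ k & forall x, C (f x) -> val x ∈ b.
  move=> f_inj Ck; have [|| b bk Sb] :=
    @bounded_of_card_lt [set val x | x in [set x : elts k | C (f x)]].
  - by move=> _ [x _ <-]; apply: set_valP.
  - apply: card_le_lt_trans Ck.
    apply: card_le_trans (card_image_le _ _) _.
    by apply: (@card_le_map _ _ _ _ f) => // x y _ _ /f_inj.
  - by exists b => // x Cx; apply: Sb; exists x.
move=> Ak Bk; have nle : ~ (elts k #<= A `|` B).
  move=> /card_le_elim[f f_inj].
  have g_inj : injective (fun x => val (f x)) := inj_comp val_inj f_inj.
  have [a ak aA] := half _ _ g_inj Ak; have [b bk bB] := half _ _ g_inj Bk.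
  have [c ck [ac bc]] := mem_max ak bk.
  apply: (@mem_irr c).
  by case: (set_valP (f (SigSub (mem_set ck)))) => [/aA/ac|/bB/bc].
(* The union has a cardinality, and cardinalities are comparable with k. *)
split=> //; have [a aE] := zset_of_card_le (card_ltW Ak).
have [b bE] := zset_of_card_le (card_ltW Bk); have [c cE] := zset_setU a b.
have [m [[om _] ABm]] := card_of_card_le (card_lexx (elts c)).
rewrite cE aE bE in ABm; rewrite (card_le_eql ABm).
have [mk|->|km] := ordinal_trichotomy om ok.
- by apply: card_ltW; apply: card_lt_mem.
- exact: card_lexx.
- case: nle; rewrite (card_le_eqr ABm).
  by apply: subset_card_le => x; apply: ordinal_trans.
Qed.

(** * The structure H(k) *)

Lemma H_trans (x y : zset) : H k x -> y ∈ x -> H k y.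
Proof.
move=> Hx yx; apply: card_le_lt_trans Hx; apply: subset_card_le => z zy.
by apply: (t_trans _ _ _ y _ zy); apply: t_step.
Qed.

Lemma trans_closure_sub (S : set zset) x :
  (forall y z, S y -> z ∈ y -> S z) -> elts x `<=` S -> trans_closure x `<=` S.
Proof.
move=> trS xS y yx.
have h : forall u v, clos_trans zset (fun u v => u ∈ v) u v ->
    (v = x \/ S v) -> S u.
  move=> u v; elim=> [{}u {}v uv [vx|Sv]|{}u w {}v _ h1 _ h2 /h2 Sw].
  - by apply: xS; rewrite -vx.
  - exact: trS uv.
  - by apply: h1; right.
by apply: h yx _; left.
Qed.

Lemma H_sub (S : set zset) x : (forall y z, S y -> z ∈ y -> S z) ->
  elts x `<=` S -> card_lt S (elts k) -> H k x.
Proof.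
move=> trS xS; apply: card_le_lt_trans; apply: subset_card_le.
exact: trans_closure_sub.
Qed.

Lemma H_bounded b x : b ∈ k -> elts x `<=` elts b -> H k x.
Proof.
move=> bk xb; apply: (H_sub _ xb); last exact: card_lt_mem.
by move=> y z yb zy; apply: ordinal_trans zy => //; apply: ordinal_mem bk.
Qed.

Lemma H_ordinal a : a ∈ k -> H k a.
Proof. by move=> ak; apply: (H_bounded ak). Qed.

Definition upair x y : zset :=
  sval (zset_of (fun b : bool => if b then x else y)).

Lemma upairE x y : elts (upair x y) = [set x; y].
Proof.
rewrite /upair; case: zset_of => z /= ->; apply/seteqP; split.
  by move=> _ [[] _ <-]; [left|right].
by move=> w [->|->]; [exists true|exists false].
Qed.

Lemma H_upair x y : H k x -> H k y -> H k (upair x y).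
Proof.
move=> Hx Hy; pose S := [set x; y] `|` (trans_closure x `|` trans_closure y).
apply: (@H_sub S); last 2 first.
- by rewrite upairE => z; left.
- apply: card_lt_setU; last exact: card_lt_setU.
  apply: countable_card_lt => //; apply: finite_set_countable.
  exact: finite_set2.
have st u v w : trans_closure u v -> w ∈ v -> trans_closure u w.
  by move=> vu wv; apply: (t_trans _ _ _ v) => //; apply: t_step.
move=> u v [[->|->]|[ux|uy]] vu.
- by right; left; apply: t_step.
- by right; right; apply: t_step.
- by right; left; apply: st vu.
- by right; right; apply: st vu.
Qed.

Lemma H_countable (S : set zset) x : S `<=` elts k -> countable S ->
  elts x = S -> H k x.
Proof.
move=> Sk Sc xS.
have [b bk Sb] := bounded_of_card_lt Sk (countable_card_lt k_unc Sc).
by apply: (H_bounded bk); rewrite xS.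
Qed.

Lemma H_zempty : H k zempty.
Proof. by apply: (@H_countable set0) => //; apply: elts_zempty. Qed.

Lemma zone_upair : zone = upair zempty zempty.
Proof.
apply: elts_inj; rewrite upairE setUid; apply/seteqP; split=> x.
  by move=> /elts_cls[_ ->].
by move=> ->; apply/elts_cls; exists tt.
Qed.

Lemma H_bool (b : bool) : H k (if b then zone else zempty).
Proof.
by case: b; rewrite ?zone_upair; [apply: H_upair|]; apply: H_zempty.
Qed.

Definition opair x y : zset := upair (upair x x) (upair x y).

Lemma opair_inj x y x' y' : opair x y = opair x' y' -> x = x' /\ y = y'.
Proof.
move=> /(congr1 elts); rewrite !upairE => e.
have exx : x = x'.
  have : [set upair x' x'; upair x' y'] (upair x x) by rewrite -e; left.
  case=> /(congr1 elts); rewrite !upairE => e'.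
    by have [//|//] : [set x'; x'] x by rewrite -e'; left.
  by have [] : [set x; x] x' by rewrite e'; left.
split=> //; subst x'.
have up u v : [set upair x x; upair x u] = [set upair x x; upair x v] ->
    u = v \/ u = x.
  move=> e1.
  have : [set upair x x; upair x v] (upair x u) by rewrite -e1; right.
  case=> /(congr1 elts); rewrite !upairE => e'.
    by have [] : [set x; x] u; [rewrite -e'; right|right|right].
  by have [] : [set x; v] u; [rewrite -e'; right|right|left].
have [//|yx] := up _ _ e; have [//|y'x] := up _ _ (esym e).
by rewrite yx y'x.
Qed.

Lemma H_opair x y : H k x -> H k y -> H k (opair x y).
Proof. by move=> Hx Hy; do !apply: H_upair. Qed.

(** For an [a] in [k] with two elements, the pairs of elements of [k] are the
    functions from [a] to [k], which the hypothesis maps into [k]. *)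
Lemma pairing_exists : weak_power_eq k ->
  exists p : elts k -> elts k -> elts k,
    forall x y x' y', p x y = p x' y' -> x = x' /\ y = y'.
Proof.
move=> /card_eqP[F].
have [|a ak] := @card_lt_ordinal k _ [set: bool] k_card.
  exact/countable_card_lt/countableP.
rewrite card_eq_sym => /card_bijP[t [t' tK t'K]].
pose A : elts k := SigSub (mem_set ak).
pose q x y : {a : elts k & elts (val a) -> elts k} :=
  existT _ A (fun u => if val (t u) then x else y).
have qb x y x' y' b : q x y = q x' y' ->
    (if b then x else y) = (if b then x' else y') :> elts k.
  (* G compares dependent pairs without transporting along equal indices. *)
  pose G (r : {a : elts k & elts (val a) -> elts k}) (z w : zset) :=
    exists2 u, val u = z & val (projT2 r u) = w.
  pose u := t' (to_setT b); have tu : val (t u) = b by rewrite t'K.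
  move=> /(congr1 (fun r => G r (val u) (val (if b then x else y)))) /= e.
  have : G (q x y) (val u) (val (if b then x else y)).
    by exists u; rewrite //= tu.
  by rewrite e => -[v /val_inj -> /=]; rewrite tu => /val_inj.
exists (fun x y => F (to_setT (q x y))) => x y x' y'.
move=> pq; have e : q x y = q x' y' := congr1 val (injT pq).
by split; [exact: (qb _ _ _ _ true e)|exact: (qb _ _ _ _ false e)].
Qed.

End RegularCardinal.

(** * Formulas *)

Definition FOr p q := FNot (FAnd (FNot p) (FNot q)).
Definition FImp p q := FNot (FAnd p (FNot q)).
Definition FIff p q := FAnd (FImp p q) (FImp q p).
Definition FAll i p := FNot (FEx i (FNot p)).

Section Connectives.
Variable M : structure.
Implicit Types (v : nat -> dom M) (p q : formula) (P Q : Prop).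

Lemma holds_and v p q P Q :
  (holds v p <-> P) -> (holds v q <-> Q) -> (holds v (FAnd p q) <-> P /\ Q).
Proof. by move=> /= -> ->. Qed.

Lemma holds_not v p P : (holds v p <-> P) -> (holds v (FNot p) <-> ~ P).
Proof. by move=> /= ->. Qed.

Lemma holds_or v p q P Q :
  (holds v p <-> P) -> (holds v q <-> Q) -> (holds v (FOr p q) <-> P \/ Q).
Proof.
move=> /= -> ->; split=> [nPQ|PQ [] nP nQ]; last by case: PQ.
by apply: contrapT => nPQ'; apply: nPQ; split=> ?; apply: nPQ'; [left|right].
Qed.

Lemma holds_imp v p q P Q :
  (holds v p <-> P) -> (holds v q <-> Q) -> (holds v (FImp p q) <-> (P -> Q)).
Proof.
move=> /= -> ->; split=> [nPQ HP|PQ [] /PQ //].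
by apply: contrapT => nQ; apply: nPQ.
Qed.

Lemma holds_iff v p q P Q :
  (holds v p <-> P) -> (holds v q <-> Q) -> (holds v (FIff p q) <-> (P <-> Q)).
Proof. by move=> hp hq; apply: holds_and; apply: holds_imp. Qed.

Lemma holds_ex v i p (P : dom M -> Prop) :
  (forall d, holds (update v i d) p <-> P d) ->
  (holds v (FEx i p) <-> exists d, P d).
Proof. by move=> h /=; split=> -[d /h]; exists d. Qed.

Lemma holds_all v i p (P : dom M -> Prop) :
  (forall d, holds (update v i d) p <-> P d) ->
  (holds v (FAll i p) <-> forall d, P d).
Proof.
move=> h /=; split=> [nP d|Pd [d]]; last by case; apply/h.
by apply: contrapT => nPd; apply: nP; exists d => /h.
Qed.

End Connectives.

Lemma update_eq D (v : nat -> D) i d : update v i d i = d.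
Proof. by rewrite /update eqxx. Qed.

Lemma update_ltn D (v : nat -> D) i j d : (j < i)%N -> update v i d j = v j.
Proof. by move=> ji; rewrite /update ltn_eqF. Qed.

(** Variables from 9 on are reserved for the quantifiers of the formulas below:
    [F_rel] binds 9 and 10, [F_opair] 11 and 12, and [F_upair] 13, so that none
    of them captures an argument that it receives from the previous one.  The
    values of a function are 0 and 1, so [F_true] asks for a nonempty value; the
    indices are recognized as the domain of the first function. *)
Definition F_true (S : nat -> nat -> formula) i :=
  FEx 9 (FAnd (S i 9) (FEx 10 (FMem 10 9))).
Definition F_index i := FEx 9 (FS1 i 9).
Definition F_upair z x y :=
  FAll 13 (FIff (FMem 13 z) (FOr (FEq 13 x) (FEq 13 y))).
Definition F_opair z x y :=
  FEx 11 (FEx 12 (FAnd (F_upair 11 x x)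
    (FAnd (F_upair 12 x y) (F_upair z 11 12)))).
Definition F_rel x y z :=
  FEx 9 (FEx 10 (FAnd (FS0 9) (FAnd (F_opair 10 x y) (F_opair 9 10 z)))).
Definition F_all_index i p := FAll i (FImp (F_index i) p).
Definition F_ex_index i p := FEx i (FAnd (F_index i) p).

Section Semantics.
Variables (k : zset).
Hypotheses (k_card : is_cardinal k) (k_unc : uncountable k)
  (k_reg : regular k).

Definition Hel x (Hx : H k x) : H k := SigSub (mem_set Hx).

Definition idx (a : elts k) : H k := Hel (H_ordinal k_card (set_valP a)).

Lemma idx_inj : injective idx.
Proof. by move=> a b /(congr1 val) /= /val_inj. Qed.

Definition coded_rel (Q : elts k -> elts k -> elts k -> Prop) : set (H k) :=
  [set x | exists a b c,
     val x = opair (opair (val a) (val b)) (val c) /\ Q a b c].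

Variables (Q : elts k -> elts k -> elts k -> Prop) (f g h : cantor_space k).
Let M := Hstructure (coded_rel Q) f g h.
Implicit Type v : nat -> dom M.

Lemma holds_index v i : (i < 9)%N ->
  holds v (F_index i) <-> exists a, v i = idx a.
Proof.
move=> i9; rewrite /=; split=> [[d [a [ai _]]]|[a ai]].
  by rewrite update_ltn // in ai; exists a; apply: val_inj.
exists (Hel (H_bool k_card k_unc k_reg (f a))), a.
by rewrite update_ltn // ai update_eq.
Qed.

Lemma holds_true S (F : cantor_space k) v i a :
  (forall v i j, holds v (S i j) <-> graph F (v i) (v j)) ->
  (i < 9)%N -> v i = idx a -> holds v (F_true S i) <-> F a.
Proof.
move=> SF i9 ia.
have one_mem : zempty ∈ zone by apply/elts_cls; exists tt.
split=> [/= [d [/SF[b []]]]|Fa].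
  rewrite update_ltn // update_eq ia => ab db [z].
  have ba : b = a by apply: val_inj.
  rewrite update_ltn // !update_eq db ba; by case: (F a) => // /elts_cls[[]].
exists (Hel (H_bool k_card k_unc k_reg (F a))); split.
  by apply/SF; exists a; rewrite update_ltn // ia update_eq.
exists (Hel (H_zempty k_card k_unc k_reg)) => /=.
by rewrite Fa.
Qed.

Lemma holds_upair v z x y : (z < 13)%N -> (x < 13)%N -> (y < 13)%N ->
  holds v (F_upair z x y) <-> val (v z) = upair (val (v x)) (val (v y)).
Proof.
move=> z13 x13 y13; have -> : holds v (F_upair z x y) <->
    forall w : H k, val w ∈ val (v z) <-> w = v x \/ w = v y.
  apply: holds_all => w; apply: holds_iff; last apply: holds_or;
    by rewrite /= ?update_eq ?update_ltn.
split=> [zE|->]; last first.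
  move=> w; rewrite upairE; split=> [[]/val_inj->|[]->]; by [left|right].
apply: elts_inj; rewrite upairE; apply/seteqP; split=> w.
  move=> wz; have Hw : H k w by apply: H_trans wz; apply: set_valP.
  by have [] := (zE (Hel Hw)).1 wz => <-; [left|right].
by move=> [] ->; apply/zE; [left|right].
Qed.

Lemma holds_opair v z x y : (z < 11)%N -> (x < 11)%N -> (y < 11)%N ->
  holds v (F_opair z x y) <-> val (v z) = opair (val (v x)) (val (v y)).
Proof.
move=> z11 x11 y11.
have lt i : (i < 11)%N -> (i < 12)%N && (i < 13)%N.
  by move=> i11; rewrite !(leq_trans i11).
have [/andP[z12 z13] /andP[x12 x13] /andP[y12 y13]] :=
  And3 (lt _ z11) (lt _ x11) (lt _ y11).
have -> : holds v (F_opair z x y) <-> exists u w : H k,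
    val u = upair (val (v x)) (val (v x)) /\
    val w = upair (val (v x)) (val (v y)) /\ val (v z) = upair (val u) (val w).
  apply: holds_ex => u; apply: holds_ex => w.
  apply: holds_and; last apply: holds_and;
    by rewrite holds_upair // !(update_eq, update_ltn).
split=> [[u [w [ux [wxy ->]]]]|zE]; first by rewrite ux wxy.
have Hx := set_valP (v x); have Hy := set_valP (v y).
exists (Hel (H_upair k_card k_unc k_reg Hx Hx)).
by exists (Hel (H_upair k_card k_unc k_reg Hx Hy)).
Qed.

Lemma holds_rel v x y z a b c : (x < 9)%N -> (y < 9)%N -> (z < 9)%N ->
  v x = idx a -> v y = idx b -> v z = idx c ->
  holds v (F_rel x y z) <-> Q a b c.
Proof.
move=> x9 y9 z9 xa yb zc.
have lt i : (i < 9)%N -> (i < 10)%N && (i < 11)%N.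
  by move=> i9; rewrite !(leq_trans i9).
have [/andP[z10 z11] /andP[x10 x11] /andP[y10 y11]] :=
  And3 (lt _ z9) (lt _ x9) (lt _ y9).
have -> : holds v (F_rel x y z) <-> exists t u : H k, coded_rel Q t /\
    val u = opair (val a) (val b) /\ val t = opair (val u) (val c).
  apply: holds_ex => t; apply: holds_ex => u.
  apply: holds_and; last apply: holds_and.
  - by rewrite /= update_ltn // update_eq.
  - by rewrite holds_opair // !(update_eq, update_ltn) // xa yb.
  - by rewrite holds_opair // !(update_eq, update_ltn) // zc.
split=> [[t [u [[a' [b' [c' [tE Qabc]]]] [uE]]]]|Qabc].
  rewrite tE uE => /opair_inj[/opair_inj[]].
  move=> /val_inj aa' /val_inj bb' /val_inj cc'.
  by rewrite -aa' -bb' -cc'.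
have Hk (d : elts k) : H k (val d) := H_ordinal k_card (set_valP d).
have Hab := H_opair k_card k_unc k_reg (Hk a) (Hk b).
exists (Hel (H_opair k_card k_unc k_reg Hab (Hk c))), (Hel Hab).
by split=> //; exists a, b, c.
Qed.

Lemma holds_all_index v i p (P : elts k -> Prop) : (i < 9)%N ->
  (forall a, holds (update v i (idx a)) p <-> P a) ->
  holds v (F_all_index i p) <-> forall a, P a.
Proof.
move=> i9 pP; have -> : holds v (F_all_index i p) <->
    forall d : H k, (exists a, d = idx a) -> holds (update v i d) p.
  apply: holds_all => d; apply: holds_imp => //.
  by rewrite holds_index // update_eq.
by split=> [Pi a|Pi _ [a ->]]; apply/pP; [apply: Pi; exists a|].
Qed.

Lemma holds_ex_index v i p (P : elts k -> Prop) : (i < 9)%N ->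
  (forall a, holds (update v i (idx a)) p <-> P a) ->
  holds v (F_ex_index i p) <-> exists a, P a.
Proof.
move=> i9 pP; have -> : holds v (F_ex_index i p) <->
    exists d : H k, (exists a, d = idx a) /\ holds (update v i d) p.
  apply: holds_ex => d; apply: holds_and => //.
  by rewrite holds_index // update_eq.
split=> [[_ [[a ->] /pP Pa]]|[a /pP pa]]; first by exists a.
by exists (idx a); split=> //; exists a.
Qed.

Lemma holds_mem v i j (x y : zset) : val (v i) = x -> val (v j) = y ->
  holds v (FMem i j) <-> x ∈ y.
Proof. by move=> /= -> ->. Qed.

Lemma holds_eq v i j (a b : elts k) : v i = idx a -> v j = idx b ->
  holds v (FEq i j) <-> a = b.
Proof. by move=> /= -> ->; split=> [/idx_inj|->]. Qed.

Lemma holds_true1 v i a : (i < 9)%N -> v i = idx a ->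
  holds v (F_true FS1 i) <-> f a.
Proof. exact: holds_true. Qed.

Lemma holds_true2 v i a : (i < 9)%N -> v i = idx a ->
  holds v (F_true FS2 i) <-> g a.
Proof. exact: holds_true. Qed.

Lemma holds_true3 v i a : (i < 9)%N -> v i = idx a ->
  holds v (F_true FS3 i) <-> h a.
Proof. exact: holds_true. Qed.

Lemma models_iff p P : (forall v, holds v p <-> P) -> models M p <-> P.
Proof.
move=> pP; split=> [/(_ (fun=> Hel (H_zempty k_card k_unc k_reg)))/pP //|HP v].
exact/pP.
Qed.

End Semantics.

(** Equality of the values of [F] is an equivalence relation, whose classes are
    the fibres of [F] and so correspond to the values of [F]. *)
Lemma sigma11_of_invariant (k : zset) (p : formula) (R : set (H k)) (Y : Type)
    (F : cantor_space k -> Y) (B : set Y) :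
  sentence p -> (forall f g, sim p R f g <-> F f = F g) -> range F = B ->
  exists E : cantor_space k -> cantor_space k -> Prop,
    Sigma11_equivalence E /\ classes E #= B.
Proof.
move=> sp simF FB; exists (sim p R); split.
  exists p, R; split=> //; split=> [f|f g /simF fg|f g h /simF fg /simF gh];
    by apply/simF; congruence.
pose C y := [set g | y = F g].
have -> : classes (sim p R) = C @` B.
  have CF f : [set g | sim p R f g] = C (F f).
    by apply/funext => g; apply/propext; apply: simF.
  rewrite -FB; apply/seteqP; split=> [_ [f ->]|_ [_ [f _ <-] <-]].
    by exists (F f); [exists f|rewrite -CF].
  by exists f; rewrite -CF.
apply: inj_card_eq => y z /set_mem; rewrite -FB => -[f _ <-] _ e.
have : C (F f) f by [].
by rewrite e.
Qed.
(** Reads off the meaning of a concrete formula connective by connective. *)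
Ltac solve_holds := repeat lazymatch goal with
  | |- holds _ (FAnd _ _) <-> _ => apply: holds_and
  | |- holds _ (FOr _ _) <-> _ => apply: holds_or
  | |- holds _ (FImp _ _) <-> _ => apply: holds_imp
  | |- holds _ (FIff _ _) <-> _ => apply: holds_iff
  | |- holds _ (FNot _) <-> _ => apply: holds_not
  | |- holds _ (FAll _ _) <-> _ => apply: holds_all => ?
  | |- holds _ (FEx _ _) <-> _ => apply: holds_ex => ?
  | |- holds _ (F_all_index _ _) <-> _ => apply: holds_all_index => // ?
  | |- holds _ (F_ex_index _ _) <-> _ => apply: holds_ex_index => // ?
  | |- holds _ (F_rel _ _ _) <-> _ => by apply: holds_rel
  | |- holds _ (F_true FS1 _) <-> _ => by apply: holds_true1
  | |- holds _ (F_true FS2 _) <-> _ => by apply: holds_true2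
  | |- holds _ (F_true FS3 _) <-> _ => by apply: holds_true3
  | |- holds _ (FMem _ _) <-> _ => by apply: holds_mem
  | |- holds _ (FEq _ _) <-> _ => by apply: holds_eq
  end.

Section Invariants.
Variables (k : zset).
Hypotheses (k_card : is_cardinal k) (k_unc : uncountable k)
  (k_reg : regular k).

Lemma sim_of_holds (Q : elts k -> elts k -> elts k -> Prop) p
    (f g : cantor_space k) P :
  (forall h v, holds (M := Hstructure (coded_rel Q) f g h) v p <-> P) ->
  sim p (coded_rel Q) f g <-> P.
Proof.
move=> pP; have mP h := models_iff k_card k_unc k_reg (pP h).
by split=> [[h /mP]|/mP HP] //; exists (fun=> false); apply: HP.
Qed.

(** * Two to the k classes *)

Definition F_same :=
  F_all_index 0 (FIff (F_true FS1 0) (F_true FS2 0)).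

Lemma eq_cantor (f g : cantor_space k) : f = g <-> forall a, f a <-> g a.
Proof.
split=> [->//|fg]; apply/funext => a.
by apply/idP/idP => /fg.
Qed.

Lemma sigma11_two_power :
  exists E : cantor_space k -> cantor_space k -> Prop,
    Sigma11_equivalence E /\ classes E #= elts (two_power k).
Proof.
pose Q (_ _ _ : elts k) := False.
have [//|f g||E [sE cE]] := @sigma11_of_invariant k F_same (coded_rel Q)
  (cantor_space k) id setT.
- by rewrite eq_cantor; apply: sim_of_holds => h v; rewrite /F_same; solve_holds.
- by apply/seteqP; split=> // f _; exists f.
exists E; split=> //; apply: card_eq_trans cE _.
by case: (two_powerP k).
Qed.

(** * At most k classes *)

Definition F_first S i :=
  FAnd (F_true S i) (F_all_index 1 (FImp (FMem 1 i) (FNot (F_true S 1)))).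

(** The ternary relation of the parameter codes a set of indices here, so its
    three arguments coincide. *)
Definition F_same_first :=
  F_all_index 0 (FImp (F_rel 0 0 0) (FIff (F_first FS1 0) (F_first FS2 0))).

Definition first_true (f : cantor_space k) a :=
  f a /\ forall b : elts k, val b ∈ val a -> ~ f b.

Lemma first_true_uniq f a b : first_true f a -> first_true f b -> a = b.
Proof.
move=> [fa amin] [fb bmin]; apply: val_inj.
have oe (c : elts k) : is_ordinal (val c).
  by apply: ordinal_mem (set_valP c); case: k_card.
have [ab|//|ba] := ordinal_trichotomy (oe a) (oe b).
  by case: (bmin _ ab).
by case: (amin _ ba).
Qed.

Lemma sigma11_ordinal m : is_ordinal m -> m <> zempty -> elts m `<=` elts k ->
  exists E : cantor_space k -> cantor_space k -> Prop,
    Sigma11_equivalence E /\ classes E #= elts m.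
Proof.
move=> om m0 mk.
(* The index 0 is left out, so that 0 can be the value of F when S f is empty. *)
pose Q (a _ _ : elts k) := val a ∈ m /\ val a <> zempty.
pose S f := [set x | exists2 a, val a = x & Q a a a /\ first_true f a].
pose F f := xget zempty (S f).
have FQ f a : Q a a a -> first_true f a <-> F f = val a.
  move=> Qa; split=> fa.
    apply: xget_unique; first by exists a.
    by move=> _ [b <- [_ fb]]; rewrite (first_true_uniq fa fb).
  have [[x Sx]|no] := pselect (exists x, S f x).
    have := xgetPex zempty (ex_intro _ x Sx).
    by rewrite -/(F f) fa => -[b /val_inj -> []].
  have : F f = zempty by apply: xgetPN => x Sx; apply: no; exists x.
  by rewrite fa; case: Qa.
apply: (@sigma11_of_invariant k F_same_first (coded_rel Q) _ F) => // [f g|].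
  have -> : F f = F g <->
      forall a, Q a a a -> (first_true f a <-> first_true g a).
    split=> [fg a Qa|fg]; first by rewrite !FQ // fg.
    have [[_ [a _ [Qa fa]]]|no] := pselect (exists x, S f x).
      by rewrite ((FQ f a Qa).1 fa); apply/esym/FQ/fg.
    rewrite /F !xgetPN // => x Sx; apply: no; exists x => //.
    by case: Sx => a ax [Qa ga]; exists a => //; split=> //; apply/fg.
  apply: sim_of_holds => h v.
  by rewrite /F_same_first /F_first; solve_holds.
apply/seteqP; split=> [_ [f _ <-]|x xm].
  rewrite /F; case: xgetP => [y _ [a <- [[]]] //|_].
  exact: zempty_mem.
have [x0|x0] := pselect (x = zempty).
  exists (fun=> false) => //; rewrite /F xgetPN ?x0 // => y.
  by case=> a _ [_ []].
pose a : elts k := SigSub (mem_set (mk _ xm)).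
exists (fun b => b == a) => //; apply/(FQ _ a) => //; split=> // b ba /eqP ab.
by apply: (@mem_irr (val a)); rewrite {1}ab in ba.
Qed.

End Invariants.

(** * Branches of a tree *)

Lemma tree_wf T (lt : T -> T -> Prop) : is_tree lt -> well_founded lt.
Proof.
move=> [_ tr wo] t; apply: contrapT => nt.
have [_ _ mn] := wo t.
have [||m [mt nm] mmin] := mn [set s | lt s t /\ ~ Acc lt s].
- by move=> s [].
- apply: contrapT => no; apply: nt; constructor=> s st; apply: contrapT => ns.
  by apply: no; exists s.
apply: nm; constructor=> s sm; apply: contrapT => ns.
by apply: (mmin s) => //; split=> //; apply: tr mt.
Qed.

(** Related points have collapses related by membership, which is irreflexive;
    so no two distinct points can have the same collapse. *)
Lemma collapse_total U (r : U -> U -> Prop) rk :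
  (forall x y, [\/ r x y, x = y | r y x]) -> collapses r rk ->
  injective rk /\ forall x y, r x y <-> rk x ∈ rk y.
Proof.
move=> tot rkE; have mono x y : r x y -> rk x ∈ rk y.
  by rewrite rkE => xy; exists x.
have rk_inj : injective rk.
  by move=> x y e; have [/mono|//|/mono] := tot x y; rewrite e => /mem_irr.
split=> // x y; split; first exact: mono.
by rewrite rkE => -[z zy /rk_inj <-].
Qed.

(** The parameter codes all triples whose first two members are related in the
    tree, so any index can stand in the third place. *)
Definition F_branch S :=
  FAnd (F_all_index 0 (F_all_index 1 (FImp (FAnd (F_true S 0) (F_true S 1))
    (FOr (F_rel 0 1 0) (FOr (FEq 0 1) (F_rel 1 0 0))))))
  (FAnd (F_all_index 0 (F_all_index 1
    (FImp (FAnd (F_true S 1) (F_rel 0 1 0)) (F_true S 0))))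
  (FAnd (F_all_index 0 (F_ex_index 1 (FAnd (F_true S 1) (FNot (FMem 1 0)))))
  (F_all_index 0 (FImp (F_true S 0)
    (F_ex_index 1 (F_all_index 2 (FImp (F_rel 2 0 0) (FMem 2 1)))))))).

Definition F_same_branch := FImp (FOr (F_branch FS1) (F_branch FS2)) F_same.

Section Branches.
Variables (k : zset).
Hypotheses (k_card : is_cardinal k) (k_unc : uncountable k)
  (k_reg : regular k).
Variables (T : Type) (lt : T -> T -> Prop).
Hypothesis lt_tree : is_tree lt.
Variables (c : T -> elts k) (d : elts k -> T).
Hypotheses (cK : cancel c d) (dK : cancel d c).

(** The last two clauses are how first order logic says that the order type is
    [k]: a subset of [k] is unbounded when it has size [k], and bounded when it
    has size less than [k]. *)
Definition branch_code (f : cantor_space k) :=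
  (forall a b, f a /\ f b -> lt (d a) (d b) \/ a = b \/ lt (d b) (d a)) /\
  (forall a b, f b /\ lt (d a) (d b) -> f a) /\
  (forall a : elts k, exists b : elts k, f b /\ ~ (val b ∈ val a)) /\
  (forall a, f a ->
     exists b : elts k, forall e, lt (d e) (d a) -> val e ∈ val b).

Definition decoded (f : cantor_space k) : set T := [set t | f (c t)].

(** The order isomorphism with [k] gives the set size [k], hence makes it
    unbounded, and indexes the predecessors of each node by an element of [k],
    hence makes them bounded by regularity. *)
Lemma decoded_branch f : is_branch k lt (decoded f) -> branch_code f.
Proof.
move=> [lin down [h [[h' hK h'K] hord]]].
have fB a : f a -> decoded f (d a) by rewrite /decoded /= dK.
split=> [a b [fa fb]|].
  have [|/(can_inj dK)|] := lin _ _ (fB _ fa) (fB _ fb);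
    by [left|right; left|right; right].
split=> [a b [fb ab]|].
  by have := down _ _ (fB _ fb) ab; rewrite /decoded /= dK.
split=> [a|a fa].
  apply: contrapT => no.
  have [_] := card_lt_mem k_card (set_valP a); case.
  have ha x : val (c (val (h x))) ∈ val a.
    apply: contrapT => na; apply: no; exists (c (val (h x))); split=> //.
    exact: (set_valP (h x)).
  apply: (@card_le_type _ _ _ _ (fun x => SigSub (mem_set (ha x)))).
  move=> x y /(congr1 val) /= /val_inj /(can_inj cK) /val_inj.
  exact: can_inj hK x y.
pose x := h' (SigSub (mem_set (fB _ fa))).
have hx : val (h x) = d a by rewrite /x h'K.
have up (u : elts (val x)) : val u \in elts k.
  apply/mem_set/(@ordinal_trans _ (val x)); [by case: k_card|exact: set_valP|].
  exact: set_valP.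
have [b bk hb] := k_reg (set_valP x) (fun u => c (val (h (SigSub (up u))))).
exists (SigSub (mem_set bk)) => e ea.
have de : decoded f (d e) by apply: down ea; exact: (fB _ fa).
pose y := h' (SigSub (mem_set de)).
have hy : val (h y) = d e by rewrite /y h'K.
have yx : val y ∈ val x by apply/hord; rewrite hx hy.
have := hb (SigSub (mem_set yx)).
have -> : SigSub (up (SigSub (mem_set yx))) = y by apply: val_inj.
by rewrite hy dK.
Qed.

(** The collapse of the decoded set is an ordinal.  It is not below [k],
    since by regularity the set would be bounded; it does not exceed [k], since
    then some bounded set of predecessors would have size [k]. *)
Lemma branch_decoded f : branch_code f -> is_branch k lt (decoded f).
Proof.
move=> [lin [down [unb bnd]]].
have lin' x y : decoded f x -> decoded f y -> [\/ lt x y, x = y | lt y x].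
  move=> fx fy; have [] := lin _ _ (conj fx fy); rewrite !cK.
    by constructor 1.
  by case=> [/(can_inj cK)|]; [constructor 2|constructor 3].
have down' x y : decoded f y -> lt x y -> decoded f x.
  by move=> fy xy; apply: (down _ (c y)); rewrite !cK.
split=> //; pose B := decoded f.
pose r (x y : B) := lt (val x) (val y).
pose code (x : B) := val (c (val x)).
have code_inj : injective code by move=> x y /val_inj/(can_inj cK)/val_inj.
have code_k x : code x ∈ k by apply: set_valP.
have rwf : well_founded r.
  exact: (wf_inverse_image _ _ _ _ (tree_wf lt_tree)).
have [rk rkE] := collapse_exists code_inj code_k rwf.
have rtot x y : [\/ r x y, x = y | r y x].
  have [] := lin' _ _ (set_valP x) (set_valP y);
    by [constructor 1|move/val_inj; constructor 2|constructor 3].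
have [rk_inj rk_mono] := collapse_total rtot rkE.
have [a aE] := zset_image rk code_inj code_k.
have oa : is_ordinal a.
  apply: (collapse_ordinal rwf _ rkE aE) => x y z.
  by case: lt_tree => _ tr _; apply: tr.
have inv x : x ∈ a -> exists u, rk u = x by rewrite aE => -[u _ <-]; exists u.
have ok : is_ordinal k by case: k_card.
suff ak : a = k.
  have /choice[h hE] (x : elts k) : exists u, rk u = val x.
    by apply: inv; rewrite ak; apply: set_valP.
  have rkk u : rk u ∈ k by rewrite -ak aE; exists u.
  exists h; split; last by move=> x y; rewrite -!hE; split=> /rk_mono.
  exists (fun u => SigSub (mem_set (rkk u))) => [x|u].
    by apply: val_inj; rewrite /= hE.
  by apply: rk_inj; rewrite hE.
have [ak|//|ka] := ordinal_trichotomy oa ok.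
  have /choice[h hE] (x : elts a) : exists u, rk u = val x.
    by apply: inv; apply: set_valP.
  have [b bk hb] := k_reg ak (fun x => c (val (h x))).
  have [e [fe]] := unb (SigSub (mem_set bk)); case.
  have de : decoded f (d e) by rewrite /decoded /= dK.
  have rka : rk (SigSub (mem_set de)) ∈ a.
    by rewrite aE; exists (SigSub (mem_set de)).
  have := hb (SigSub (mem_set rka)).
  by rewrite (rk_inj _ _ (hE (SigSub (mem_set rka)))) /= dK.
have [t tk] := inv _ ka.
have [|b tb] := bnd (c (val t)); first exact: (set_valP t).
have [_] := card_lt_mem k_card (set_valP b); case.
have kE : elts k = rk @` [set s | r s t] by rewrite -rkE tk.
move: (val b) tb => b' tb; rewrite kE.
apply: card_le_trans (card_image_le _ _) _.
apply: (@card_le_map _ _ _ _ code) => [s st|s s' _ _ /code_inj //].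
by apply: tb; rewrite !cK.
Qed.

Lemma sigma11_branches :
  exists E : cantor_space k -> cantor_space k -> Prop,
    Sigma11_equivalence E /\ classes E #= [set: option (branches k lt)].
Proof.
pose Q (a b _ : elts k) := lt (d a) (d b).
pose F (f : cantor_space k) : option (branches k lt) :=
  match pselect (branches k lt (decoded f)) with
  | left Bf => Some (SigSub (mem_set Bf))
  | right _ => None
  end.
have codeP f : branch_code f <-> branches k lt (decoded f).
  by split; [apply: branch_decoded|apply: decoded_branch].
apply: (@sigma11_of_invariant k F_same_branch (coded_rel Q) _ F) => // [f g|].
  have -> : F f = F g <->
      (branch_code f \/ branch_code g -> forall a, f a <-> g a).
    rewrite -eq_cantor !codeP /F.
    case: pselect => Bf; case: pselect => Bg.
    - split=> [[e] _|fg]; last first.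
        by congr Some; apply: val_inj; rewrite /= fg //; left.
      apply/funext => a; have := congr1 (fun B : set T => B (d a)) e.
      rewrite /decoded /= dK => e'.
      by apply/idP/idP; rewrite e'.
    - by split=> // fg; case: Bg; rewrite -fg; [|left].
    - by split=> // fg; case: Bf; rewrite fg; [|right].
    - by split=> // _ [].
  apply: (sim_of_holds k_card k_unc k_reg) => h v.
  by rewrite /F_same_branch /F_branch /F_same; solve_holds.
apply/seteqP; split=> // -[B|] _; last first.
  exists (fun=> false) => //; rewrite /F; case: pselect => // Bf.
  have [_ [_ [unb _]]] := (codeP _).2 Bf; have [a] := k_inhabited k_card k_unc.
  by have [b []] := unb a.
exists (fun a => `[< val B (d a) >]) => //.
have e : decoded (fun a => `[< val B (d a) >]) = val B.
  apply/funext => t; apply/propext; rewrite /decoded /= cK.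
  by split=> /asboolP.
rewrite /F; case: pselect => [BB|]; first by congr Some; apply: val_inj.
by rewrite e; case; apply: set_valP.
Qed.

End Branches.

(** * Heights of well-founded relations *)

Definition F_edge S i j :=
  F_ex_index 8 (FAnd (F_rel i j 8) (F_true S 8)).

Definition F_transitive S :=
  F_all_index 0 (F_all_index 1 (F_all_index 2
    (FImp (F_edge S 0 1) (FImp (F_edge S 1 2) (F_edge S 0 2))))).

Definition F_minima S :=
  FAll 0 (FImp (F_ex_index 1 (FMem 1 0)) (F_ex_index 1 (FAnd (FMem 1 0)
    (F_all_index 2 (FImp (FMem 2 0) (FNot (F_edge S 2 1))))))).

Definition F_ranked S := FAnd (F_transitive S) (F_minima S).

Definition F_total_bisimulation :=
  FAnd (F_all_index 0 (F_ex_index 1 (F_edge FS3 0 1)))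
  (FAnd (F_all_index 1 (F_ex_index 0 (F_edge FS3 0 1)))
  (F_all_index 0 (F_all_index 1 (FImp (F_edge FS3 0 1)
    (FAnd
      (F_all_index 2 (FImp (F_edge FS1 2 0)
        (F_ex_index 3 (FAnd (F_edge FS2 3 1) (F_edge FS3 2 3)))))
      (F_all_index 3 (FImp (F_edge FS2 3 1)
        (F_ex_index 2 (FAnd (F_edge FS1 2 0) (F_edge FS3 2 3)))))))))).

Definition F_same_height :=
  FOr (FAnd (FNot (F_ranked FS1)) (FNot (F_ranked FS2)))
    (FAnd (FAnd (F_ranked FS1) (F_ranked FS2)) F_total_bisimulation).

Section Heights.
Variables (k : zset).
Hypotheses (k_card : is_cardinal k) (k_unc : uncountable k)
  (k_reg : regular k).
Variable pair : elts k -> elts k -> elts k.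
Hypothesis pair_inj :
  forall x y x' y', pair x y = pair x' y' -> x = x' /\ y = y'.

Definition rel_of (f : cantor_space k) (x y : elts k) : Prop := f (pair x y).

Lemma rel_of_surj (r : elts k -> elts k -> Prop) :
  exists f, forall x y, rel_of f x y <-> r x y.
Proof.
exists (fun z => `[< exists x y, pair x y = z /\ r x y >]) => x y.
rewrite /rel_of; split=> [/asboolP[x' [y' [/pair_inj[-> ->]]]] //|xy].
by apply/asboolP; exists x, y.
Qed.

Definition has_minima (r : elts k -> elts k -> Prop) :=
  forall s : H k, (exists x : elts k, val x ∈ val s) ->
    exists x : elts k, val x ∈ val s /\
      forall y : elts k, val y ∈ val s -> ~ r y x.

(** A descending sequence is a countable subset of [k], hence bounded, hence
    an element of [H k]; so [H k] sees whether a relation is well-founded. *)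
Lemma has_minima_wf r : has_minima r <-> well_founded r.
Proof.
split=> [rmin x0|rwf s [x]]; last first.
  elim: (rwf x) => {}x _ IH xs.
  have [[y [ys yx]]|no] := pselect (exists y : elts k, val y ∈ val s /\ r y x).
    exact: IH yx ys.
  by exists x; split=> // y ys yx; apply: no; exists y.
apply: contrapT => nx0.
have /choice[next nextP] (x : {x | ~ Acc r x}) :
    exists y : {y | ~ Acc r y}, r (sval y) (sval x).
  case: x => x nx; apply: contrapT => no; case: (nx); constructor=> y yx.
  by apply: contrapT => ny; apply: no; exists (exist _ y ny).
pose u n := sval (iter n next (exist _ x0 nx0)).
have [s sE] := zset_of (fun n => val (u n)).
have Hs : H k s.
  apply: (@H_countable k k_card k_unc k_reg (range (fun n => val (u n)))) => //.
    by move=> _ [n _ <-]; apply: set_valP.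
  exact: card_image_le.
have [|x [/=]] := rmin (Hel Hs); first by exists (u 0); rewrite /= sE; exists 0.
rewrite {1}sE => -[n _ /val_inj <-] /(_ (u n.+1)) /=.
by case; [rewrite sE; exists n.+1|apply: nextP].
Qed.

Definition ranked f := transitive_rel (rel_of f) /\ has_minima (rel_of f).

Definition has_height f (a : zset) := ranked f /\
  exists2 rk, collapses (rel_of f) rk & elts a = range rk.

(** The collapse of a relation on [k] has a nonempty image, so the default value
    is not the height of any ranked function. *)
Definition height f : zset := xget zempty (has_height f).

Lemma heightP f : ranked f -> has_height f (height f).
Proof.
move=> rf; apply: xgetPex; have [_ /has_minima_wf rwf] := rf.
have val_k (x : elts k) : val x ∈ k := set_valP x.
have [rk rkE] := collapse_exists val_inj val_k rwf.
have [a aE] := zset_image rk val_inj val_k.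
by exists a; split=> //; exists rk.
Qed.

Lemma height_junk f : ~ ranked f -> height f = zempty.
Proof. by move=> nf; apply: xgetPN => a []. Qed.

Definition same_height_by f g h :=
  (~ ranked f /\ ~ ranked g) \/
  ((ranked f /\ ranked g) /\
   (forall x, exists y, rel_of h x y) /\ (forall y, exists x, rel_of h x y) /\
   bisimulation (rel_of f) (rel_of g) (rel_of h)).

Lemma bisimulation_height f g h a b : has_height f a -> has_height g b ->
  (forall x, exists y, rel_of h x y) -> (forall y, exists x, rel_of h x y) ->
  bisimulation (rel_of f) (rel_of g) (rel_of h) -> a = b.
Proof.
move=> [[_ /has_minima_wf rwf] [rk rkE aE]] [_ [rk' rk'E bE]] tot1 tot2 hb.
have e := bisimulation_collapse rwf rkE rk'E hb.
apply: elts_inj; rewrite aE bE; apply/seteqP; split=> _ [x _ <-].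
  by have [y xy] := tot1 x; exists y => //; rewrite (e _ _ xy).
by have [y yx] := tot2 x; exists y => //; rewrite (e _ _ yx).
Qed.

Lemma has_height_uniq f a b : has_height f a -> has_height f b -> a = b.
Proof.
have [h hE] := rel_of_surj eq.
move=> fa fb; apply: (bisimulation_height fa fb (h := h)) => [x|x|x y /hE <-].
- by exists x; apply/hE.
- by exists x; apply/hE.
- by split=> z zx; exists z; split=> //; apply/hE.
Qed.

Lemma height_nonempty f : ranked f -> height f <> zempty.
Proof.
move=> /heightP[_ [rk _ hE]] f0; have [a] := k_inhabited k_card k_unc.
have : range rk (rk a) by exists a.
by rewrite -hE f0 => /elts_cls[[]].
Qed.

Lemma height_eq f g : height f = height g <-> exists h, same_height_by f g h.
Proof.
split=> [fg|[h [[nf ng]|[[rf rg] [tot1 [tot2 hb]]]]]]; last 2 first.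
- by rewrite !height_junk.
- exact: bisimulation_height (heightP rf) (heightP rg) tot1 tot2 hb.
have [rf|nf] := pselect (ranked f); last first.
  exists f; left; split=> // /height_nonempty; apply; rewrite -fg.
  exact: height_junk.
have rg : ranked g.
  apply: contrapT => ng; apply: (height_nonempty rf); rewrite fg.
  exact: height_junk.
have [_ [rk rkE fE]] := heightP rf; have [_ [rk' rk'E gE]] := heightP rg.
have [h hE] := rel_of_surj (fun x y => rk x = rk' y).
exists h; right; split=> //; split=> [x|].
  have : range rk' (rk x) by rewrite -gE -fg fE; exists x.
  by case=> y _ yx; exists y; apply/hE.
split=> [y|x y /hE xy].
  have : range rk (rk' y) by rewrite -fE fg gE; exists y.
  by case=> x _ xy; exists x; apply/hE.
split=> z zr.
  have : elts (rk' y) (rk z) by rewrite -xy rkE; exists z.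
  by rewrite rk'E => -[w wy wz]; exists w; split=> //; apply/hE.
have : elts (rk x) (rk' z) by rewrite xy rk'E; exists z.
by rewrite rkE => -[w wx wz]; exists w; split=> //; apply/hE.
Qed.

Lemma succ_card_mem a : is_ordinal a ->
  a ∈ succ_card k <-> elts a #<= elts k.
Proof.
have [[ol cl] kl lmin] := succ_cardP k_card.
move: (succ_card k) ol cl kl lmin => l ol cl kl lmin oa; split=> [al|ak].
  have [m [[om cm] am]] := card_of_card_le (card_lexx (elts a)).
  have ml : m ∈ l.
    have [ma|->//|aM] := ordinal_trichotomy om oa.
      exact: ordinal_trans al ma.
    by have := cm _ aM; rewrite am.
  rewrite (card_le_eql am); have ok : is_ordinal k by case: k_card.
  have [mk|->|km] := ordinal_trichotomy om ok.
  - by apply: subset_card_le => x; apply: ordinal_trans.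
  - exact: card_lexx.
  - have [ml'|lm] := lmin m (conj om cm) km.
      by rewrite ml' in ml; case: (mem_irr ml).
    by case: (@mem_irr l); apply: ordinal_trans ml lm.
have kl' : card_lt (elts k) (elts l) by apply: card_lt_mem.
have [//|al|la] := ordinal_trichotomy oa ol.
  by case: kl' => _; rewrite -al.
case: kl' => _; case; apply: card_le_trans ak.
by apply: subset_card_le => x; apply: ordinal_trans.
Qed.

(** A surjection [s] of [k] onto a nonempty ordinal [a] of size at most [k] is
    the collapse of the relation [s x ∈ s y]. *)
Lemma range_height : range height = elts (succ_card k).
Proof.
have [junk junkE] := rel_of_surj (fun _ _ => True).
have junk0 : height junk = zempty.
  apply: height_junk => -[_ /has_minima_wf rwf].
  have [a] := k_inhabited k_card k_unc.
  by elim: (rwf a) => x _ no; apply: (no x); apply/junkE.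
have [[ol _] kl _] := succ_cardP k_card.
apply/seteqP; split=> [_ [f _ <-]|a al].
  have [rf|nf] := pselect (ranked f); last first.
    rewrite height_junk //; apply: zempty_mem => // l0.
    by rewrite l0 in kl; case/elts_cls: kl => -[].
  have [[rtr /has_minima_wf rwf] [rk rkE hE]] := heightP rf.
  apply/succ_card_mem; first exact: collapse_ordinal rwf rtr rkE hE.
  rewrite hE; apply: card_le_trans (card_image_le _ _) _.
  by rewrite (card_le_eqr (card_setT_sym (elts k))) card_lexx.
have [a0|a0] := pselect (a = zempty); first by exists junk => //; rewrite junk0.
have oa := ordinal_mem ol al.
have /card_le_elim[j j_inj] := (succ_card_mem oa).1 al.
have za := zempty_mem oa a0.
(* s inverts j, and takes the value 0 outside the image of j. *)
have /choice[s sE] (x : elts k) : exists y, y ∈ a /\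
    forall u : elts a, j u = x -> y = val u.
  have [[u ux]|no] := pselect (exists u, j u = x).
    exists (val u); split; first exact: set_valP.
    by move=> w wx; congr val; apply: j_inj; rewrite ux wx.
  by exists zempty; split=> // u ux; case: no; exists u.
have aE : elts a = range s.
  apply/seteqP; split=> [y ya|_ [x _ <-]]; last by case: (sE x).
  exists (j (SigSub (mem_set ya))) => //.
  by have [_ /(_ _ erefl)] := sE (j (SigSub (mem_set ya))).
have [f fE] := rel_of_surj (fun x y => s x ∈ s y).
exists f => //; have fa : has_height f a.
  split; last first.
    exists s => // x; apply/seteqP; split=> [y yx|_ [y /fE yx <-] //].
    have : elts a y by apply: ordinal_trans yx; case: (sE x).
    by rewrite aE => -[z _ zy]; exists z => //; apply/fE; rewrite zy.
  split=> [x y z /fE xy /fE yz|].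
    apply/fE; apply: ordinal_trans yz xy.
    by apply: ordinal_mem oa _; case: (sE z).
  apply/has_minima_wf => x; elim: (mem_wf (s x)) {-2}x (erefl (s x)).
  move=> {}y _ IH x0 x0y; constructor=> z /fE zx.
  by apply: (IH (s z)) => //; rewrite -x0y.
exact: has_height_uniq (heightP (proj1 fa)) fa.
Qed.

Definition pair_graph (x y z : elts k) := z = pair x y.

Lemma holds_edge S (F : cantor_space k) f g h
    (v : nat -> dom (Hstructure (coded_rel pair_graph) f g h))
    i j a b :
  (forall v i j, holds (M := Hstructure (coded_rel pair_graph) f g h)
     v (S i j) <-> graph F (v i) (v j)) ->
  (i < 8)%N -> (j < 8)%N -> v i = idx k_card a -> v j = idx k_card b ->
  holds v (F_edge S i j) <-> rel_of F a b.
Proof.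
move=> SF i8 j8 ia jb.
have -> : rel_of F a b <-> exists z, z = pair a b /\ F z.
  by split=> [ab|[_ [->]]] //; exists (pair a b).
apply: holds_ex_index => // z; apply: holds_and.
  apply: (holds_rel k_unc k_reg (Q := pair_graph) (a := a) (b := b) (c := z));
    by rewrite ?update_eq ?update_ltn ?(leqW i8) ?(leqW j8).
by apply: (holds_true k_unc k_reg SF) => //; rewrite update_eq.
Qed.

Lemma sigma11_succ_card :
  exists E : cantor_space k -> cantor_space k -> Prop,
    Sigma11_equivalence E /\ classes E #= elts (succ_card k).
Proof.
apply: (@sigma11_of_invariant k F_same_height
  (coded_rel pair_graph) _ height) => // [f g|]; last first.
  exact: range_height.
rewrite height_eq.
have hP h : models (Hstructure (coded_rel pair_graph) f g h)
    F_same_height <-> same_height_by f g h.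
  apply: (models_iff k_card k_unc k_reg) => v.
  rewrite /F_same_height /F_ranked /F_transitive /F_minima.
  rewrite /F_total_bisimulation.
  rewrite /same_height_by /ranked /transitive_rel /has_minima /bisimulation.
  repeat (lazymatch goal with
  | |- holds _ (F_edge FS1 _ _) <-> _ => by apply: (holds_edge (F := f))
  | |- holds _ (F_edge FS2 _ _) <-> _ => by apply: (holds_edge (F := g))
  | |- holds _ (F_edge FS3 _ _) <-> _ => by apply: (holds_edge (F := h))
  | _ => progress solve_holds
  end).
by split=> -[h1 same]; exists h1; apply/hP.
Qed.

End Heights.

(** * The three families of equivalence relations *)

Theorem lemma3p2 (k : zset) (k_card : is_cardinal k) (k_unc : uncountable k)
    (k_reg : regular k) (k_pow : weak_power_eq k) :
  (forall m : zset, is_cardinal m -> m <> zempty ->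
     [\/ m ∈ k, m = k | m = two_power k] ->
     exists E : cantor_space k -> cantor_space k -> Prop,
       Sigma11_equivalence E /\ classes E #= elts m)
  /\
  (exists E : cantor_space k -> cantor_space k -> Prop,
     Sigma11_equivalence E /\ classes E #= elts (succ_card k))
  /\
  (forall (T : Type) (lt : T -> T -> Prop), is_tree lt ->
     [set: T] #= elts k ->
     exists E : cantor_space k -> cantor_space k -> Prop,
       Sigma11_equivalence E /\ classes E #= [set: option (branches k lt)]).
Proof.
have ok : is_ordinal k by case: k_card.
split=> [m [om _] m0 mk|].
  have [->|small] := pselect (m = two_power k); first exact: sigma11_two_power.
  apply: sigma11_ordinal => // x xm; case: mk => [mk|<- //|//].
  exact: ordinal_trans xm.
split=> [|T lt lt_tree /card_bijP[c [d cK dK]]].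
  have [pair pair_inj] := pairing_exists k_card k_unc k_pow.
  exact: sigma11_succ_card pair_inj.
have cK' : cancel (c \o to_setT) (val \o d) by move=> t /=; rewrite cK.
have dK' : cancel (val \o d) (c \o to_setT).
  by move=> a; rewrite -[RHS]dK /=; congr c; apply: val_inj.
exact: sigma11_branches cK' dK'.
Qed.
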